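(* Let $f:\mathbb{R}^d\to\mathbb{R}$ be a $\mathcal{C}^4$ strongly convex function and let $B(\mathbf{x})\in\mathbb{R}^{d\times d}$ be symmetric positive definite, $C(\mathbf{x})=B(\mathbf{x})\nabla^2 f(\mathbf{x})$, $C_0(\mathbf{x})=\nabla^2 f(\mathbf{x})B(\mathbf{x})\nabla^2 f(\mathbf{x})$. Suppose that there exist constants $L\ge\mu>0$ with $\mu\le1$ such that $\mu\mathbb{I}\preceq C_0(\mathbf{x})\preceq L\mathbb{I}$ for all $\mathbf{x}$, and that there exists a constant $L'>0$ such that $$C(\mathbf{x})^T\big(\nabla^3 f(\mathbf{x})\nabla f(\mathbf{x})+(\nabla^2 f(\mathbf{x}))^2\big)C(\mathbf{x})\preceq L'\mathbb{I}\quad\text{for all }\mathbf{x}.$$ Let $(\mathbf{x}^n,\mathbf{p}^n)_{n\ge0}$ be the iterates of the linearized primal-dual damping algorithm with $\sigma=\tau$, $\gamma=\frac{1-\sigma\mu}{\mu}$, $\varepsilon=1$, $A=\frac{\mu+L}{2+(\mu+L)\varepsilon\gamma}$. Suppose that for some $\delta>0$ and all $\mathbf{x}$, $$\mathcal{I}(\mathbf{x}^0,\mathbf{p}^0)^{1/2}\le\frac{\delta}{\tau D_0\|N(\mathbf{x})\|_2^3}.$$ If $\tau=\frac14\,\frac{\mu}{\delta+36\max\{L',1\}}$, then $$\mathcal{I}(\mathbf{x}^n,\mathbf{p}^n)\le\mathcal{I}(\mathbf{x}^0,\mathbf{p}^0)\Big(1-\frac{\mu^2/32}{\delta+36\max\{L',1\}}\Big)^n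 .$$
   Context: The iterates of the linearized primal-dual damping algorithm with parameters $\tau,\sigma,A,\varepsilon,\omega>0$, $\gamma=\sigma\omega$, from an initial pair $(\mathbf{x}^0,\mathbf{p}^0)\in\mathbb{R}^{2d}$, are $$\mathbf{p}^{n+1}=\tfrac{1}{1+\sigma\varepsilon A}\mathbf{p}^n+\tfrac{\sigma A}{1+\sigma\varepsilon A}\nabla f(\mathbf{x}^n),\qquad \mathbf{x}^{n+1}=\mathbf{x}^n-\tau B(\mathbf{x}^n)\nabla^2 f(\mathbf{x}^n)\Big(\tfrac{1-\varepsilon\gamma A}{1+\sigma\varepsilon A}\mathbf{p}^n+\tfrac{\sigma A+\gamma A}{1+\sigma\varepsilon A}\nabla f(\mathbf{x}^n)\Big).$$ Define (scalars in blocks multiply the $d\times d$ identity) $$N(\mathbf{x})=\frac{1}{1+\sigma\varepsilon A}\begin{pmatrix}B(\mathbf{x})\nabla^2 f(\mathbf{x})(\sigma A+\gamma A)&B(\mathbf{x})\nabla^2 f(\mathbf{x})(1-\varepsilon\gamma A)\\-\frac{\sigma}{\tau}A&\frac{\sigma}{\tau}\varepsilon A\end{pmatrix},\qquad \mathcal{I}(\mathbf{x},\mathbf{p})=\tfrac12\|\nabla f(\mathbf{x})\|^2+\tfrac12\|\mathbf{p}\|^2,$$ $$D_0=\sup_{\mathbf{x},\mathbf{p},\mathbf{x}',\mathbf{p}'}\frac{\begin{pmatrix}\mathbf{x}'\\\mathbf{p}'\end{pmatrix}^T\left(\nabla^3\mathcal{I}(\mathbf{x},\mathbf{p})\begin{pmatrix}\mathbf{x}'\\\mathbf{p}'\end{pmatrix}\right)\begin{pmatrix}\mathbf{x}'\\\mathbf{p}'\end{pmatrix}}{\left\|\begin{pmatrix}\mathbf{x}'\\\mathbf{p}'\end{pmatrix}\right\|_2^3},$$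 the supremum being over $(\mathbf{x},\mathbf{p})\in\mathbb{R}^{2d}$ and nonzero $(\mathbf{x}',\mathbf{p}')\in\mathbb{R}^{2d}$, with $\nabla^3\mathcal{I}$ the third derivative of $\mathcal{I}$ in $(\mathbf{x},\mathbf{p})$. Here $\nabla^3 f(\mathbf{x})\nabla f(\mathbf{x})$ is the matrix with entries $\sum_k\partial_{ijk}f(\mathbf{x})\,\partial_kf(\mathbf{x})$. $\|\cdot\|_2$ is the Euclidean norm of a vector or the spectral norm of a matrix, $\mathbb{I}$ the identity matrix, and $\preceq$ the Loewner order. *)

(* Defs.v *)
From HB Require Import structures.
From mathcomp Require Import all_boot all_order all_algebra.
From mathcomp Require Import all_classical all_reals all_analysis.

Set Implicit Arguments.
Unset Strict Implicit.
Unset Printing Implicit Defensive.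

Import Order.TTheory GRing.Theory Num.Theory.
Import numFieldNormedType.Exports.

Local Open Scope classical_set_scope.
Local Open Scope ring_scope.

Section Euclidean.
Context {R : realType}.

(* The library's norm `|v| on matrices is the max-norm. *)
Definition enorm n (v : 'cV[R]_n) : R := Num.sqrt (\sum_(i < n) v i 0 ^+ 2).

Definition spectral_norm m n (M : 'M[R]_(m, n)) : R :=
  sup [set enorm (M *m v) / enorm v | v in [set v : 'cV[R]_n | v != 0]].

Definition qform n (M : 'M[R]_n) (v : 'cV[R]_n) : R := (v^T *m M *m v) 0 0.

Definition psdmx n (M : 'M[R]_n) : Prop :=
  M^T = M /\ forall v : 'cV[R]_n, 0 <= qform M v.

Definition pdmx n (M : 'M[R]_n) : Prop :=
  M^T = M /\ forall v : 'cV[R]_n, v != 0 -> 0 < qform M v.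

Definition loewner_le n (P Q : 'M[R]_n) : Prop := psdmx (Q - P).

End Euclidean.

Section Derivatives.
Context {R : realType}.

Definition partial n (i : 'I_n) (f : 'cV[R]_n -> R) : 'cV[R]_n -> R :=
  fun x => 'D_(delta_mx i 0) f x.

Fixpoint Ck (k : nat) n (f : 'cV[R]_n -> R) : Prop :=
  if k is k'.+1 then
    (forall x, differentiable f x) /\ (forall i, Ck k' (partial i f))
  else continuous f.

Definition grad n (f : 'cV[R]_n -> R) (x : 'cV[R]_n) : 'cV[R]_n :=
  \col_i partial i f x.

Definition hess n (f : 'cV[R]_n -> R) (x : 'cV[R]_n) : 'M[R]_n :=
  \matrix_(i, j) partial i (partial j f) x.

(* The third derivative of f at x contracted with v in its last index. *)
Definition d3mul n (f : 'cV[R]_n -> R) (x v : 'cV[R]_n) : 'M[R]_n :=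
  \matrix_(i, j) \sum_(k < n) partial i (partial j (partial k f)) x * v k 0.

Definition strongly_convex n (f : 'cV[R]_n -> R) : Prop :=
  exists2 m : R, 0 < m &
    convex_function [set: 'cV[R]_n] (fun x => f x - m / 2 * enorm x ^+ 2).

End Derivatives.

Section LinearizedPDD.
Context {R : realType} {d : nat}.
Implicit Types (f : 'cV[R]_d -> R) (B : 'cV[R]_d -> 'M[R]_d).

Definition Cmx f B (x : 'cV[R]_d) : 'M[R]_d := B x *m hess f x.

Definition C0mx f B (x : 'cV[R]_d) : 'M[R]_d := hess f x *m B x *m hess f x.

Definition lpdd_iterates f B (tau sigma A eps gamma : R)
    (x p : nat -> 'cV[R]_d) : Prop :=
  forall n : nat,
    p n.+1 = (1 / (1 + sigma * eps * A)) *: p n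
             + (sigma * A / (1 + sigma * eps * A)) *: grad f (x n)
    /\
    x n.+1 = x n - tau *: (B (x n) *m hess f (x n) *m
               (((1 - eps * gamma * A) / (1 + sigma * eps * A)) *: p n
                + ((sigma * A + gamma * A) / (1 + sigma * eps * A))
                    *: grad f (x n))).

Definition Nmx f B (tau sigma A eps gamma : R) (x : 'cV[R]_d) : 'M[R]_(d + d) :=
  (1 / (1 + sigma * eps * A)) *:
    block_mx ((sigma * A + gamma * A) *: (B x *m hess f x))
             ((1 - eps * gamma * A) *: (B x *m hess f x))
             (- (sigma / tau * A))%:M
             (sigma / tau * eps * A)%:M.

Definition energy f (x p : 'cV[R]_d) : R :=
  2^-1 * enorm (grad f x) ^+ 2 + 2^-1 * enorm p ^+ 2.

Definition energy2d f (z : 'cV[R]_(d + d)) : R :=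
  energy f (usubmx z) (dsubmx z).

(* The supremum is extended-real: it may be +oo. *)
Definition D0 f : \bar R :=
  ereal_sup [set r : \bar R | exists z w : 'cV[R]_(d + d),
    w != 0 /\ r = (qform (d3mul (energy2d f) z w) w / enorm w ^+ 3)%:E].

End LinearizedPDD.

(* Main.v *)
Require Import Defs.
From HB Require Import structures.
From mathcomp Require Import all_boot all_order all_algebra.
From mathcomp Require Import all_classical all_reals all_analysis.
From mathcomp Require Import ring lra.

Set Implicit Arguments.
Unset Strict Implicit.
Unset Printing Implicit Defensive.

Import Order.TTheory GRing.Theory Num.Theory.
Import numFieldNormedType.Exports.

Local Open Scope ring_scope.

(** The step is [z_(n+1) = z_n - tau * N u], where [z = (x, p)] and
[u = (g, p)], [g = grad f x], satisfies [|u|^2 = 2 * E] for the energy [E] of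
[z]. The energy is expanded along this step to third order.

With [a = A / (1 + tau * A)] and [q = mu^-1 g + 2 / (mu + L) p], the choice of
the parameters turns [N u] into [a * (C q, p - g)], and
[1 / a = 2 / (mu + L) + 1 / mu] gives [mu / 2 <= a <= mu] ([step_scalars]).

- First order. The gradient of the energy is [(H g, p)] with [H] the Hessian of
  [f], and [H] is symmetric by Schwarz's theorem ([derive_comm]), so that the
  first-order term is [- tau * a] times [q . C0 g + (p - g) . p]. The term
  [q . C0 g] has a diagonal part [C0 / mu >= 1] and an off-diagonal part which
  combines with [- p . g] to the form of [2 / (mu + L) C0 - 1], a matrix with
  spectrum in [-1, 1]. Hence the sum is at least [E] ([first_order_ge]).
- Second order. The Hessian of the energy is block diagonal with blocks
  [d3mul f x g + H^2] and 1, and the hypothesis on the third derivative gives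
  at most [4 * tau^2 * max(L', 1) * E] ([second_order_le]).
- Third order. The initial condition is designed so that the remainder is at
  most [tau^2 * delta * E / 2] as long as the energy does not exceed its
  initial value ([third_order_le]).

Altogether the energy is multiplied by at most
[1 - tau * (mu / 2 - tau * (4 * max(L', 1) + delta / 2))], and the choice of
[tau] makes [tau * (delta + 36 * max(L', 1)) = mu / 4], so that at least
[tau * mu / 4] is gained, twice what is claimed. In particular the energy
decreases, and the argument applies to all steps by induction. *)

(** * Directional derivatives and the classes Ck *)

Section DirectionalDerivatives.
Context {R : realType}.
Local Open Scope classical_set_scope.

Lemma derive_partial n (g : 'cV[R]_n -> R) (w z : 'cV[R]_n) :
  differentiable g z -> 'D_w g z = \sum_(i < n) w i 0 * partial i g z.
Proof.
move=> dg; rewrite deriveE// [w in LHS]matrix_sum_delta linear_sum.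
apply: eq_bigr => i _; rewrite big_ord1 linearZ /= /partial deriveE//.
Qed.

Lemma derive_comp_linear n m (L : {linear 'cV[R]_m -> 'cV[R]_n})
    (g : 'cV[R]_n -> R) (w z : 'cV[R]_m) :
  'D_w (g \o L) z = 'D_(L w) g (L z).
Proof.
rewrite /derive [X in lim (X @ _)](_ : _ =
  (fun h : R => h^-1 *: ((g \o shift (L z)) (h *: L w) - g (L z)))) //.
by apply/funext => h /=; rewrite (linearP L).
Qed.

(** Restricting to a line turns directional derivatives into ordinary ones, so
that one-variable results (mean value theorem, Taylor) apply. *)
Lemma is_derive_line n (g : 'cV[R]_n -> R) (z w : 'cV[R]_n) (t : R) :
  differentiable g (z + t *: w) ->
  is_derive t 1 (fun s : R => g (z + s *: w)) ('D_w g (z + t *: w)).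
Proof.
move=> dg.
have E : (fun h : R => h^-1 *: (((fun s : R => g (z + s *: w)) \o shift t) (h *: 1)
            - g (z + t *: w)))
       = (fun h : R => h^-1 *: ((g \o shift (z + t *: w)) (h *: w)
            - g (z + t *: w))).
  apply/funext => h /=; congr (_ *: (g _ - _)).
  by rewrite [h *: 1]mulr1 scalerDl addrCA.
have dgw := diff_derivable (v := w) dg.
split; first by rewrite /derivable E; exact: dgw.
by rewrite {1}/derive E.
Qed.

Lemma derive_coord n (i : 'I_n) (v z : 'cV[R]_n) :
  'D_v (fun y : 'cV[R]_n => y i 0) z = v i 0.
Proof.
apply: (cvg_lim (@Rhausdorff R)); apply: cvg_near_cst; near=> h.
rewrite /= !mxE addrK -[_^-1 *: _]/(_^-1 * _) mulKf//.
by near: h; exact: nbhs_dnbhs_neq.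
Unshelve. all: by end_near. Qed.

Lemma CkS k n (g : 'cV[R]_n -> R) : Ck k.+1 g -> Ck k g.
Proof.
elim: k g => [|k IH] g [dg pg] /=.
  by move=> z; exact: differentiable_continuous.
by split=> // i; apply: IH.
Qed.

Lemma Ck_cst k n (c : R) : Ck k (fun _ : 'cV[R]_n => c).
Proof.
elim: k c => [|k IH] c /=; first exact: cst_continuous.
split=> [x|i]; first exact: differentiable_cst.
rewrite (_ : partial i _ = fun=> 0); first exact: IH.
by apply/funext => x; rewrite /partial derive_cst.
Qed.

Lemma CkD k n (g h : 'cV[R]_n -> R) : Ck k g -> Ck k h -> Ck k (g + h).
Proof.
elim: k g h => [|k IH] g h /=.
  by move=> cg ch x; apply: continuousD; [exact: cg|exact: ch].
move=> [dg pg] [dh ph]; split=> [x|i]; first exact: differentiableD.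
rewrite (_ : partial i _ = partial i g + partial i h); first exact: IH.
by apply/funext => x; rewrite /partial deriveD//; exact: diff_derivable.
Qed.

Lemma CkM k n (g h : 'cV[R]_n -> R) : Ck k g -> Ck k h -> Ck k (g * h).
Proof.
elim: k g h => [|k IH] g h.
  by move=> cg ch x; apply: continuousM; [exact: cg|exact: ch].
move=> Cg Ch; have [dg pg] := Cg; have [dh ph] := Ch.
split=> [x|i]; first exact: differentiableM.
rewrite (_ : partial i _ = g * partial i h + h * partial i g).
  by apply: CkD; apply: IH; [exact: CkS Cg|exact: ph|exact: CkS Ch|exact: pg].
by apply/funext => x; rewrite /partial deriveM//; exact: diff_derivable.
Qed.

Lemma Ck_sum k n m (g : 'I_m -> 'cV[R]_n -> R) :
  (forall i, Ck k (g i)) -> Ck k (\sum_(i < m) g i).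
Proof.
by move=> Cg; elim/big_ind: _ => // [|? ? ? ?]; [exact: Ck_cst|exact: CkD].
Qed.

Lemma Ck_coord k n (i : 'I_n) : Ck k (fun z : 'cV[R]_n => z i 0).
Proof.
case: k => [|k] /=; first by move=> x; exact: coord_continuous.
split=> [x|j]; first exact: differentiable_coord.
rewrite (_ : partial j _ = fun=> (delta_mx j 0 : 'cV[R]_n) i 0); first exact: Ck_cst.
by apply/funext => x; exact: derive_coord.
Qed.

Lemma Ck_comp_linear k n m (L : {linear 'cV[R]_m -> 'cV[R]_n})
    (g : 'cV[R]_n -> R) :
  continuous L -> Ck k g -> Ck k (g \o L).
Proof.
move=> cL; elim: k g => [|k IH] g.
  by move=> cg x; apply: continuous_comp; [exact: cL|exact: cg].
move=> /= [dg pg]; split=> [x|i].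
  by apply: differentiable_comp => //; exact: linear_differentiable.
rewrite (_ : partial i _ =
    \sum_(j < n) (fun=> L (delta_mx i 0) j 0) * (partial j g \o L)).
  by apply: Ck_sum => j; apply: CkM; [exact: Ck_cst|exact: IH].
apply/funext => x; rewrite /partial derive_comp_linear derive_partial//.
by rewrite fct_sumE; apply: eq_bigr.
Qed.

(** The form of [derive_partial] to be differentiated once more: an applied
derivative is not an instance of the function [fun z => 'D_w g z]. *)
Lemma derive_partial_fun n (g : 'cV[R]_n -> R) (w : 'cV[R]_n) :
  (forall z, differentiable g z) ->
  'D_w g = \sum_(i < n) (fun=> w i 0) * partial i g.
Proof.
by move=> dg; apply/funext => z; rewrite derive_partial// fct_sumE.
Qed.

Lemma Ck_derive k n (g : 'cV[R]_n -> R) (w : 'cV[R]_n) :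
  Ck k.+1 g -> Ck k ('D_w g).
Proof.
move=> [dg pg]; rewrite derive_partial_fun//.
by apply: Ck_sum => i; apply: CkM; [exact: Ck_cst|exact: pg].
Qed.

Lemma derive_lincomb n m (c : 'I_m -> R) (g : 'I_m -> 'cV[R]_n -> R)
    (v z : 'cV[R]_n) :
  (forall i y, differentiable (g i) y) ->
  'D_v (\sum_(i < m) (fun=> c i) * g i) z = \sum_(i < m) c i * 'D_v (g i) z.
Proof.
move=> dg; have dg' i := diff_derivable (v := v) (dg i z).
rewrite derive_sum => [|i]; last exact: derivableM.
by apply: eq_bigr => i _; rewrite deriveM// derive_cst scaler0 addr0.
Qed.

Lemma derive2E n (g : 'cV[R]_n -> R) (w z : 'cV[R]_n) : Ck 2 g ->
  'D_w ('D_w g) z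
  = \sum_(i < n) \sum_(j < n) w i 0 * partial i (partial j g) z * w j 0.
Proof.
move=> [dg Cg]; have dpg i y : differentiable (partial i g) y by have [] := Cg i.
rewrite derive_partial_fun// (derive_lincomb (fun i => w i 0) w z dpg).
rewrite exchange_big; apply: eq_bigr => j _ /=; rewrite derive_partial//.
by rewrite mulr_sumr; apply: eq_bigr => i _; rewrite mulrC.
Qed.

(** The numerators of the quotients in [D0] are third derivatives along lines.
The index contracted by [d3mul] is the innermost partial derivative, hence the
expansion of the innermost ['D_w] first. *)
Lemma derive3E n (g : 'cV[R]_n -> R) (w z : 'cV[R]_n) : Ck 3 g ->
  'D_w ('D_w ('D_w g)) z = qform (d3mul g z w) w.
Proof.
move=> Cg; have [dg pg] := Cg.
have dpg k y : differentiable (partial k g) y by have [] := pg k.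
have dDpg k y : differentiable ('D_w (partial k g)) y.
  by have [] : Ck 1 ('D_w (partial k g)) by exact: Ck_derive.
have -> : 'D_w ('D_w g) = \sum_(k < n) (fun=> w k 0) * 'D_w (partial k g).
  apply/funext => y; rewrite derive_partial_fun//.
  by rewrite (derive_lincomb (fun k => w k 0) w y dpg) fct_sumE.
rewrite (derive_lincomb (fun k => w k 0) w z dDpg).
under eq_bigr => k _ do rewrite derive2E//.
rewrite /qform mxE; under [RHS]eq_bigr => j _ do rewrite mxE mulr_suml.
rewrite [RHS]exchange_big.
under eq_bigr => k _ do rewrite mulr_sumr.
rewrite [LHS]exchange_big; apply: eq_bigr => i _ /=.
under eq_bigr => k _ do rewrite mulr_sumr.
rewrite [LHS]exchange_big; apply: eq_bigr => j _ /=.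
rewrite !mxE mulr_sumr mulr_suml; apply: eq_bigr => k _.
ring.
Qed.
End DirectionalDerivatives.

(** * Symmetry of second derivatives *)

Section Symmetry.
Context {R : realType}.
Local Open Scope classical_set_scope.

Lemma MVT_everywhere (r dr : R -> R) (h : R) : 0 < h ->
  (forall t : R, is_derive t 1 r (dr t)) ->
  exists c, [/\ 0 < c, c < h & r h - r 0 = dr c * h].
Proof.
move=> h0 rdr; have cr : {within `[0, h], continuous r}.
  apply: continuous_subspaceT => t; apply: differentiable_continuous.
  by apply/derivable1_diffP; have [] := rdr t.
have [c] := @MVT R r dr 0 h h0 (fun t _ => rdr t) cr.
by rewrite in_itv /= subr0 => /andP[c0 ch] E; exists c.
Qed.

(** Both mixed second derivatives are limits of the same second difference: the
left-hand side is symmetric in [u] and [v], and applying the mean value theorem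
to the variable along [u], then along [v], evaluates it at an intermediate
point. *)
Lemma mixed_difference n (g : 'cV[R]_n -> R) (u v z : 'cV[R]_n) (h : R) :
  (forall y, differentiable g y) -> (forall y, differentiable ('D_u g) y) ->
  0 < h ->
  exists s t, [/\ 0 < s < h, 0 < t < h &
    g (z + h *: v + h *: u) - g (z + h *: u) - g (z + h *: v) + g z
      = 'D_v ('D_u g) (z + s *: u + t *: v) * h * h].
Proof.
move=> dg dDg h0.
have [s [s0 sh Es]] := @MVT_everywhere
  ((fun s : R => g (z + h *: v + s *: u)) - (fun s : R => g (z + s *: u)))
  (fun s => 'D_u g (z + h *: v + s *: u) - 'D_u g (z + s *: u)) h h0
  (fun s => is_deriveB (is_derive_line (dg _)) (is_derive_line (dg _))).
have [t [t0 th Et]] := @MVT_everywhere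
  (fun t : R => 'D_u g (z + s *: u + t *: v))
  (fun t : R => 'D_v ('D_u g) (z + s *: u + t *: v)) h h0
  (fun t => is_derive_line (dDg _)).
exists s, t; split; rewrite ?s0 ?t0 ?sh ?th// -Et scale0r addr0.
rewrite [z + s *: u + _]addrAC -Es !fctE !scale0r !addr0.
by rewrite opprB addrA [RHS]addrAC.
Qed.

(** Schwarz's theorem. The points provided by [mixed_difference] for [(u, v)] and
for [(v, u)] both tend to [z] with [h], and the mixed derivatives are continuous
at [z]. *)
Lemma derive_comm n (g : 'cV[R]_n -> R) (u v z : 'cV[R]_n) : Ck 2 g ->
  'D_v ('D_u g) z = 'D_u ('D_v g) z.
Proof.
move=> Cg; have dg : forall y, differentiable g y by have [] := Cg.
have dD w : forall y, differentiable ('D_w g) y.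
  by have [] : Ck 1 ('D_w g) by exact: Ck_derive.
have cD w w' : continuous ('D_w' ('D_w g)).
  by have : Ck 0 ('D_w' ('D_w g)) by apply/Ck_derive/Ck_derive.
apply/eqP; rewrite -subr_eq0 -normr_eq0 eq_le normr_ge0 andbT.
apply/ler_addgt0Pl => e e0; rewrite addr0.
have e20 : 0 < e / 2 by rewrite divr_gt0.
have /cvgrPdist_lt/(_ _ e20)/nbhs_ballP[r1 /= r10 near1] := cD u v z.
have /cvgrPdist_lt/(_ _ e20)/nbhs_ballP[r2 /= r20 near2] := cD v u z.
pose r := Num.min r1 r2; have r0 : 0 < r by rewrite lt_min r10 r20.
(* The 1 keeps the denominator positive when u and v both vanish. *)
pose h := r / (`|u| + `|v| + 1).
have k0 : 0 < `|u| + `|v| + 1 by rewrite ltr_wpDl// addr_ge0.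
have h0 : 0 < h by rewrite divr_gt0.
have close s t w w' : 0 < s < h -> 0 < t < h ->
    `|w| + `|w'| = `|u| + `|v| -> `|z - (z + s *: w + t *: w')| < r.
  move=> /andP[s0 sh] /andP[t0 th] E.
  rewrite -addrA opprD addNKr normrN (le_lt_trans (ler_normD _ _))//.
  rewrite !normrZ !gtr0_norm// (@le_lt_trans _ _ (h * (`|u| + `|v|)))//.
    by rewrite -E mulrDr lerD// ler_wpM2r// ltW.
  rewrite /h mulrAC ltr_pdivrMr// ltr_pM2l// ltrDl//.
have [s [t [hs ht E1]]] := @mixed_difference n g u v z h dg (dD u) h0.
have [s' [t' [hs' ht' E2]]] := @mixed_difference n g v u z h dg (dD v) h0.
have E : 'D_v ('D_u g) (z + s *: u + t *: v) = 'D_u ('D_v g) (z + s' *: v + t' *: u).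
  have EE : g (z + h *: v + h *: u) - g (z + h *: u) - g (z + h *: v) + g z
      = g (z + h *: u + h *: v) - g (z + h *: v) - g (z + h *: u) + g z.
    have -> : z + h *: u + h *: v = z + h *: v + h *: u by rewrite addrAC.
    ring.
  have nz := mulIf (lt0r_neq0 h0).
  exact: nz _ _ (nz _ _ (etrans (esym E1) (etrans EE E2))).
have vu : `|v| + `|u| = `|u| + `|v| by rewrite addrC.
have B1 : ball z r1 (z + s *: u + t *: v).
  rewrite -ball_normE /=; apply: lt_le_trans (close s t u v hs ht erefl) _.
  by rewrite ge_min lexx.
have B2 : ball z r2 (z + s' *: v + t' *: u).
  rewrite -ball_normE /=; apply: lt_le_trans (close s' t' v u hs' ht' vu) _.
  by rewrite ge_min lexx orbT.
have N1 := near1 _ B1; have N2 := near2 _ B2; rewrite /= in N1 N2.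
rewrite -E in N2.
have tri (a b c : R) : `|a - c| < e / 2 -> `|b - c| < e / 2 -> `|a - b| <= e.
  move=> /ltW ac /ltW bc; rewrite (splitr e) -(subrKA c).
  by apply: le_trans (ler_normD _ _) _; apply: lerD ac _; rewrite distrC.
exact: tri N1 N2.
Qed.

End Symmetry.

(** * Taylor's inequality of order three *)

Section Taylor.
Context {R : realType}.

Lemma le_of_derive_le (u v du dv : R -> R) :
  (forall t : R, is_derive t 1 u (du t)) -> (forall t : R, is_derive t 1 v (dv t)) ->
  u 0 <= v 0 -> (forall t, 0 <= t -> du t <= dv t) ->
  forall t, 0 <= t -> u t <= v t.
Proof.
move=> hu hv uv0 duv t; rewrite le_eqVlt => /predU1P[<-//|t0].
have [c [c0 ct]] := MVT_everywhere t0 (fun s : R => is_deriveB (hv s) (hu s)).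
rewrite !fctE => E; rewrite -subr_ge0.
have : 0 <= (dv c - du c) * t by rewrite mulr_ge0 ?subr_ge0 ?duv// ltW.
by rewrite -E; lra.
Qed.

Let hornerPE := (hornerD, hornerZ, hornerC, hornerX, hornerXn, hornerM,
  hornerMn, horner0).

(** Integrating [phi3 <= K] three times, each integration being a comparison with
a polynomial having the same value at 0. *)
Lemma taylor3_le (phi phi1 phi2 phi3 : R -> R) (K : R) :
  (forall t : R, is_derive t 1 phi (phi1 t)) ->
  (forall t : R, is_derive t 1 phi1 (phi2 t)) ->
  (forall t : R, is_derive t 1 phi2 (phi3 t)) ->
  (forall t, phi3 t <= K) ->
  phi 1 <= phi 0 + phi1 0 + phi2 0 / 2 + K / 6.
Proof.
move=> d1 d2 d3 le3.
pose P2 : {poly R} := (phi2 0)%:P + K *: 'X.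
pose P1 : {poly R} := (phi1 0)%:P + phi2 0 *: 'X + (K / 2) *: 'X^2.
pose P0 : {poly R} := (phi 0)%:P + phi1 0 *: 'X + (phi2 0 / 2) *: 'X^2
                      + (K / 6) *: 'X^3.
have H2 t : 0 <= t -> phi2 t <= P2.[t].
  apply: le_of_derive_le d3 (fun t => is_derive_poly P2 t) _ _ t.
    by rewrite !hornerPE; lra.
  by move=> t _; rewrite !poly.derivE !hornerPE; have := le3 t; lra.
have H1 t : 0 <= t -> phi1 t <= P1.[t].
  apply: le_of_derive_le d2 (fun t => is_derive_poly P1 t) _ _ t.
    by rewrite !hornerPE; lra.
   by move=> t /H2; rewrite !poly.derivE !hornerPE; lra.
have H0 t : 0 <= t -> phi t <= P0.[t].
  apply: le_of_derive_le d1 (fun t => is_derive_poly P0 t) _ _ t.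
    by rewrite !hornerPE; lra.
  by move=> t /H1; rewrite !poly.derivE !hornerPE; lra.
by apply: le_trans (H0 1 ler01) _; rewrite !hornerPE; lra.
Qed.

(** The bound on the cubic form is required at all points [y], not only on the
segment from [z] to [z + w], as this is what the supremum [D0] controls. *)
Lemma taylor3_line n (g : 'cV[R]_n -> R) (z w : 'cV[R]_n) (K : R) : Ck 3 g ->
  (forall y, qform (d3mul g y w) w <= K) ->
  g (z + w) <= g z + 'D_w g z + 'D_w ('D_w g) z / 2 + K / 6.
Proof.
move=> Cg leK; have dg y : differentiable g y by have [] := Cg.
have C1 : Ck 2 ('D_w g) by exact: Ck_derive.
have C2 : Ck 1 ('D_w ('D_w g)) by exact: Ck_derive.
have dg1 y : differentiable ('D_w g) y by have [] := C1.
have dg2 y : differentiable ('D_w ('D_w g)) y by have [] := C2.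
have := @taylor3_le (fun t => g (z + t *: w)) _ _ _ K
  (fun t => is_derive_line (dg (z + t *: w)))
  (fun t => is_derive_line (dg1 (z + t *: w)))
  (fun t => is_derive_line (dg2 (z + t *: w))).
rewrite scale0r scale1r addr0; apply => t.
by rewrite derive3E.
Qed.
End Taylor.

(** * Derivatives of the energy *)

Section Energy.
Context {R : realType}.
Local Open Scope classical_set_scope.

Definition dot n (u v : 'cV[R]_n) : R := (u^T *m v) 0 0.

Lemma dotE n (u v : 'cV[R]_n) : dot u v = \sum_(i < n) u i 0 * v i 0.
Proof. by rewrite /dot mxE; apply: eq_bigr => i _; rewrite mxE. Qed.

Lemma enorm_sqr n (v : 'cV[R]_n) : enorm v ^+ 2 = dot v v.
Proof.
rewrite /enorm sqr_sqrtr; last by apply: sumr_ge0 => i _; exact: sqr_ge0.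
by rewrite dotE; apply: eq_bigr => i _; rewrite expr2.
Qed.

Lemma hess_sym n (f : 'cV[R]_n -> R) (x : 'cV[R]_n) : Ck 2 f ->
  (hess f x)^T = hess f x.
Proof. by move=> Cf; apply/matrixP => i j; rewrite !mxE; exact: derive_comm. Qed.

Lemma continuous_usubmx n m : continuous (usubmx : 'cV[R]_(n + m) -> 'cV[R]_n).
Proof.
move=> u A /nbhs_ballP[e /= e0 eA].
apply/nbhs_ballP; exists e => //= v [_ uv]; apply: eA; split => // i j.
by apply: (le_lt_trans _ (uv (lshift m i) j)); rewrite !mxE.
Qed.

Lemma derive_sumM n m (g h : 'I_m -> 'cV[R]_n -> R) (v z : 'cV[R]_n) :
  (forall i y, differentiable (g i) y) -> (forall i y, differentiable (h i) y) ->
  'D_v (\sum_(i < m) g i * h i) z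
  = \sum_(i < m) (g i z * 'D_v (h i) z + h i z * 'D_v (g i) z) :> R.
Proof.
move=> dg dh.
have dg' i := diff_derivable (v := v) (dg i z).
have dh' i := diff_derivable (v := v) (dh i z).
rewrite derive_sum => [|i]; last exact: derivableM.
by apply: eq_bigr => i _; rewrite deriveM.
Qed.

Section Energy2d.
Variables (d : nat) (f : 'cV[R]_d -> R).
Hypothesis Cf : Ck 4 f.
Implicit Types z w : 'cV[R]_(d + d).

Let pf (i : 'I_d) (z : 'cV[R]_(d + d)) : R := partial i f (usubmx z).
Let co (i : 'I_d) (z : 'cV[R]_(d + d)) : R := z (rshift d i) 0.

Lemma energy2dE : energy2d f =
  (fun=> 2^-1) * (\sum_(i < d) pf i * pf i + \sum_(i < d) co i * co i).
Proof.
apply/funext => z; rewrite /energy2d /energy !enorm_sqr !dotE.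
rewrite -mulrDr -[RHS]/(2^-1 * ((\sum_(i < d) pf i * pf i) z
  + (\sum_(i < d) co i * co i) z)) !fct_sumE.
by congr (_ * (_ + _)); apply: eq_bigr => i _; rewrite !mxE.
Qed.

Let Cpf i : Ck 3 (pf i).
Proof.
apply: (Ck_comp_linear (L := usubmx)); first exact: continuous_usubmx.
by case: Cf => _; apply.
Qed.

Lemma Ck_energy2d : Ck 3 (energy2d f).
Proof.
rewrite energy2dE; apply: CkM; first exact: Ck_cst.
by apply: CkD; apply: Ck_sum => i; apply: CkM; (exact: Cpf || exact: Ck_coord).
Qed.

Let dpf i z : differentiable (pf i) z. Proof. by case: (Cpf i) => + _; apply. Qed.
Let dco i z : differentiable (co i) z. Proof. exact: differentiable_coord. Qed.
Let dDpf i w z : differentiable ('D_w (pf i)) z.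
Proof. by have [] : Ck 2 ('D_w (pf i)) by apply: Ck_derive. Qed.

Lemma derive_energy2d w : 'D_w (energy2d f) =
  \sum_(i < d) pf i * 'D_w (pf i) + \sum_(i < d) co i * (fun=> co i w).
Proof.
apply/funext => z; rewrite energy2dE.
have dA : derivable (\sum_(i < d) pf i * pf i) z w.
  by apply: derivable_sum => i; apply: derivableM; exact: diff_derivable.
have dB : derivable (\sum_(i < d) co i * co i) z w.
  by apply: derivable_sum => i; apply: derivableM; exact: diff_derivable.
rewrite (deriveM (derivable_cst _ _ _) (derivableD dA dB)).
rewrite derive_cst scaler0 addr0 (deriveD dA dB).
rewrite (derive_sumM w z dpf dpf) (derive_sumM w z dco dco).
rewrite -[RHS]/((\sum_(i < d) _ : 'cV[R]_(d + d) -> R) z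
  + (\sum_(i < d) _ : 'cV[R]_(d + d) -> R) z) !fct_sumE.
rewrite -[LHS]/(2^-1 * (_ + _)) mulrDr !mulr_sumr; congr (_ + _).
  by apply: eq_bigr => i _; rewrite !fctE; lra.
by apply: eq_bigr => i _; rewrite derive_coord !fctE /co; lra.
Qed.

Lemma derive2_energy2d w z : 'D_w ('D_w (energy2d f)) z =
  \sum_(i < d) ('D_w (pf i) z ^+ 2 + pf i z * 'D_w ('D_w (pf i)) z)
  + \sum_(i < d) co i w ^+ 2 :> R.
Proof.
rewrite derive_energy2d.
have dA : derivable (\sum_(i < d) pf i * 'D_w (pf i)) z w.
  by apply: derivable_sum => i; apply: derivableM; exact: diff_derivable.
have dB : derivable (\sum_(i < d) co i * (fun=> co i w)) z w.
  by apply: derivable_sum => i; apply: derivableM; exact: diff_derivable.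
transitivity ('D_w (\sum_(i < d) pf i * 'D_w (pf i)) z
  + 'D_w (\sum_(i < d) co i * (fun=> co i w)) z : R); first exact: deriveD.
rewrite (derive_sumM w z dpf (dDpf^~ w)).
rewrite (derive_sumM w z dco (fun i => differentiable_cst (co i w))).
apply: (congr2 +%R); apply: eq_bigr => i _.
  rewrite [RHS]addrC.
  rewrite expr2.
  reflexivity.
rewrite derive_cst mulr0 add0r derive_coord expr2.
reflexivity.
Qed.

Let Dpf i w z : 'D_w (pf i) z = 'D_(usubmx w) (partial i f) (usubmx z).
Proof. exact: (derive_comp_linear usubmx). Qed.

Let DDpf i w z :
  'D_w ('D_w (pf i)) z = 'D_(usubmx w) ('D_(usubmx w) (partial i f)) (usubmx z).
Proof.
have -> : 'D_w (pf i) = 'D_(usubmx w) (partial i f) \o usubmx.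
  by apply/funext => y; exact: Dpf.
exact: (derive_comp_linear usubmx).
Qed.

Let Dpf_hess i w z :
  'D_w (pf i) z = ((usubmx w)^T *m hess f (usubmx z)) 0 i :> R.
Proof.
rewrite Dpf /= derive_partial; last by case: Cf => _ /(_ i)[].
by rewrite mxE; apply: eq_bigr => j _; rewrite !mxE.
Qed.

Lemma derive_energy2d_grad w z : 'D_w (energy2d f) z =
  dot (usubmx w) (hess f (usubmx z) *m grad f (usubmx z))
  + dot (dsubmx w) (dsubmx z) :> R.
Proof.
transitivity ((\sum_(i < d) pf i * 'D_w (pf i)) z
  + (\sum_(i < d) co i * (fun=> co i w)) z).
  exact: (congr1 (@^~ z) (derive_energy2d w)).
rewrite !fct_sumE; apply: (congr2 +%R).
  rewrite /dot mulmxA mxE; apply: eq_bigr => i _.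
  transitivity (pf i z * 'D_w (pf i) z : R) => //.
  by rewrite Dpf_hess mulrC; apply: (congr2 *%R); rewrite // [RHS]mxE.
by rewrite dotE; apply: eq_bigr => i _; rewrite !mxE mulrC.
Qed.

(** The Hessian of the energy is block diagonal. The first block arises as
[H *m H^T] plus the third-derivative term, and symmetry of [H] puts it in the
form in which the third-order hypothesis bounds it. *)
Lemma derive2_energy2d_hess w z : 'D_w ('D_w (energy2d f)) z =
  qform (d3mul f (usubmx z) (grad f (usubmx z))
         + hess f (usubmx z) *m hess f (usubmx z)) (usubmx w)
  + dot (dsubmx w) (dsubmx w) :> R.
Proof.
rewrite derive2_energy2d; apply: (congr2 +%R); last first.
  by rewrite dotE; apply: eq_bigr => i _; rewrite !mxE expr2.
rewrite big_split /= addrC /qform mulmxDr mulmxDl mxE; apply: (congr2 +%R).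
  under eq_bigr => k _.
    rewrite DDpf derive2E; last by apply: CkS; case: Cf => _; apply.
    rewrite mulr_sumr.
    under eq_bigr => i _ do rewrite mulr_sumr.
    over.
  rewrite mxE; under [RHS]eq_bigr => j _ do rewrite mxE mulr_suml.
  rewrite [RHS]exchange_big [LHS]exchange_big; apply: eq_bigr => i _ /=.
  rewrite [LHS]exchange_big; apply: eq_bigr => j _ /=.
  rewrite !mxE mulr_sumr mulr_suml; apply: eq_bigr => k _.
  by rewrite /pf !mxE; ring.
rewrite mulmxA -mulmxA mxE; apply: eq_bigr => i _.
rewrite Dpf_hess expr2; congr (_ * _).
have Hs : (hess f (usubmx z))^T = hess f (usubmx z) by apply/hess_sym/CkS/CkS.
transitivity ((hess f (usubmx z) *m usubmx w)^T 0 i); first by rewrite trmx_mul Hs.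
by rewrite mxE.
Qed.
End Energy2d.
End Energy.

(** * Quadratic forms and norms *)

Section QuadraticForms.
Context {R : realType}.

Lemma le_of_sqr (x y : R) : 0 <= y -> x ^+ 2 <= y ^+ 2 -> x <= y.
Proof. by move=> y0 xy; rewrite leNgt; apply/negP => yx; nra. Qed.

Lemma dotC n (u v : 'cV[R]_n) : dot u v = dot v u.
Proof. by rewrite !dotE; apply: eq_bigr => i _; rewrite mulrC. Qed.

Lemma dotDl n (u v w : 'cV[R]_n) : dot (u + v) w = dot u w + dot v w.
Proof. by rewrite /dot linearD mulmxDl mxE. Qed.

Lemma dotDr n (u v w : 'cV[R]_n) : dot w (u + v) = dot w u + dot w v.
Proof. by rewrite ![dot w _]dotC dotDl. Qed.

Lemma dotZl n (a : R) (u v : 'cV[R]_n) : dot (a *: u) v = a * dot u v.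
Proof. by rewrite /dot linearZ -scalemxAl mxE. Qed.

Lemma dotZr n (a : R) (u v : 'cV[R]_n) : dot u (a *: v) = a * dot u v.
Proof. by rewrite dotC dotZl dotC. Qed.

Lemma dotvv_ge0 n (v : 'cV[R]_n) : 0 <= dot v v.
Proof. by rewrite -enorm_sqr sqr_ge0. Qed.

Lemma qform_dot n (M : 'M[R]_n) (v : 'cV[R]_n) : qform M v = dot v (M *m v).
Proof. by rewrite /qform /dot mulmxA. Qed.

Lemma dot_mulmx n (M : 'M[R]_n) (u v : 'cV[R]_n) :
  dot (M *m u) v = dot u (M^T *m v).
Proof. by rewrite /dot trmx_mul mulmxA. Qed.

Lemma loewner_ge_scalar n (M : 'M[R]_n) (c : R) (v : 'cV[R]_n) :
  loewner_le c%:M M -> c * dot v v <= qform M v.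
Proof.
move=> [_ /(_ v)]; rewrite !qform_dot mulmxBl dotDr mul_scalar_mx -scaleN1r.
by rewrite !dotZr mulN1r subr_ge0.
Qed.

Lemma loewner_le_scalar n (M : 'M[R]_n) (c : R) (v : 'cV[R]_n) :
  loewner_le M c%:M -> qform M v <= c * dot v v.
Proof.
move=> [_ /(_ v)]; rewrite !qform_dot mulmxBl dotDr mul_scalar_mx -scaleN1r.
by rewrite !dotZr mulN1r subr_ge0.
Qed.

Lemma loewner_ge_scalar_sym n (M : 'M[R]_n) (c : R) :
  loewner_le c%:M M -> M^T = M.
Proof.
by move=> [+ _]; rewrite linearB /= tr_scalar_mx => /addIr.
Qed.

Lemma enorm_ge0 n (v : 'cV[R]_n) : 0 <= enorm v.
Proof. exact: sqrtr_ge0. Qed.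

Lemma enormZ n (a : R) (v : 'cV[R]_n) : enorm (a *: v) = `|a| * enorm v.
Proof.
apply: (@pexpIrn _ 2) => //; rewrite ?nnegrE ?mulr_ge0 ?enorm_ge0//.
by rewrite exprMn !enorm_sqr dotZl dotZr mulrA -expr2 real_normK// num_real.
Qed.

Lemma enorm_eq0 n (v : 'cV[R]_n) : (enorm v == 0) = (v == 0).
Proof.
apply/idP/eqP => [|->]; last first.
  by rewrite -(scale0r 0) enormZ normr0 mul0r.
rewrite -sqrf_eq0 enorm_sqr dotE psumr_eq0 => [/allP v0|i _]; last first.
  by rewrite -expr2 sqr_ge0.
apply/colP => i; rewrite mxE; apply/eqP.
by have /implyP/(_ isT) := v0 i (mem_index_enum i); rewrite mulf_eq0 orbb.
Qed.

Lemma enorm_col_mx n m (u : 'cV[R]_n) (v : 'cV[R]_m) :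
  enorm (col_mx u v) ^+ 2 = enorm u ^+ 2 + enorm v ^+ 2.
Proof. by rewrite !enorm_sqr /dot tr_col_mx mul_row_col mxE. Qed.

Lemma le_coord_enorm n (v : 'cV[R]_n) i : `|v i 0| <= enorm v.
Proof.
apply: le_of_sqr; first exact: enorm_ge0.
rewrite enorm_sqr dotE real_normK ?num_real//.
rewrite (bigD1 i)//= -expr2 lerDl; apply: sumr_ge0 => j _.
by rewrite -expr2 sqr_ge0.
Qed.

(** The content is that the set defining [spectral_norm] is bounded above;
otherwise its real supremum would be the default value 0. A crude bound by the
row sums of absolute values suffices. *)
Lemma enorm_mulmx n m (M : 'M[R]_(m, n)) (v : 'cV[R]_n) :
  enorm (M *m v) <= spectral_norm M * enorm v.
Proof.
have [->|v0] := eqVneq v 0.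
  have e0 k : enorm (0 : 'cV[R]_k) = 0 by apply/eqP; rewrite enorm_eq0.
  by rewrite mulmx0 !e0 mulr0.
have pos (w : 'cV[R]_n) : w != 0 -> 0 < enorm w.
  by move=> w0; rewrite lt_def enorm_ge0 enorm_eq0 w0.
rewrite -ler_pdivrMr ?pos//; apply: ub_le_sup; last by exists v.
pose K := \sum_(i < m) (\sum_(j < n) `|M i j|) ^+ 2.
have K0 : 0 <= K by apply: sumr_ge0 => i _; exact: sqr_ge0.
exists (Num.sqrt K) => _ [w /= w0 <-]; rewrite ler_pdivrMr ?pos//.
apply: le_of_sqr; first by rewrite mulr_ge0 ?enorm_ge0 ?sqrtr_ge0.
rewrite exprMn (sqr_sqrtr K0) enorm_sqr dotE mulr_suml; apply: ler_sum => i _.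
rewrite -expr2 -exprMn -real_normK ?num_real//.
apply: lerXn2r; rewrite ?nnegrE ?mulr_ge0 ?enorm_ge0 ?sumr_ge0//.
rewrite mxE (le_trans (ler_norm_sum _ _ _))// mulr_suml; apply: ler_sum => j _.
by rewrite normrM ler_wpM2l// le_coord_enorm.
Qed.

End QuadraticForms.

(** * The terms of the expansion *)

Section Step.
Context {R : realType}.

(** The cubic form is at most [D0 * enorm w ^+ 3] for the step [w], and
[enorm w <= tau * s * enorm u] with [s] the spectral norm of [N]. The initial
condition says [tau * D0 * s ^+ 3 * Num.sqrt E0 <= delta] and absorbs all but
[tau ^+ 2] and one factor [enorm u ^+ 2 = 2 * E]; the constant 3 is
[2 * Num.sqrt 2] rounded up. The extended-real quotient requires care only when
[D0] is infinite: then the condition forces [E0 <= 0] as soon as [s] is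
positive, which rules out a nonzero step. The value [-oo] is excluded by any
nonzero step. *)
Lemma third_order_le d (f : 'cV[R]_d -> R) (N : 'M[R]_(d + d))
    (u : 'cV[R]_(d + d)) (E E0 tau delta : R) :
  0 < tau -> 0 < delta -> 0 <= E -> E <= E0 -> enorm u ^+ 2 = 2 * E ->
  ((Num.sqrt E0)%:E
     <= delta%:E / (tau%:E * D0 f * (spectral_norm N ^+ 3)%:E))%E ->
  forall y, qform (d3mul (energy2d f) y (- tau *: (N *m u))) (- tau *: (N *m u))
    <= 3 * tau ^+ 2 * delta * E.
Proof.
move=> tau0 delta0 E_ge0 EE0 uE init y.
set w := - tau *: (N *m u); set s := spectral_norm N in init.
set K := 3 * tau ^+ 2 * delta * E.
have K0 : 0 <= K by rewrite !mulr_ge0 ?sqr_ge0// ltW.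
have [w0|wn0] := eqVneq w 0; first by rewrite w0 qform_dot mulmx0 /dot mulmx0 mxE.
have wpos : 0 < enorm w by rewrite lt_def enorm_ge0 enorm_eq0 wn0.
have wle : enorm w <= tau * (s * enorm u).
  by rewrite enormZ normrN gtr0_norm// ler_pM2l// enorm_mulmx.
have su0 : 0 < s * enorm u by rewrite -(pmulr_rgt0 _ tau0) (lt_le_trans wpos).
have u0 : 0 < enorm u.
  by rewrite lt_def enorm_ge0 andbT; apply: contraTneq su0 => ->; rewrite mulr0 ltxx.
have s0 : 0 < s by rewrite -(pmulr_lgt0 _ u0).
have s30 : 0 < s ^+ 3 by rewrite exprn_gt0.
have E0_gt0 : 0 < E0.
  by apply: lt_le_trans EE0; rewrite -(pmulr_rgt0 _ (ltr0Sn R 1)) -uE exprn_gt0.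
set S := Num.sqrt E0 in init; have S0 : 0 < S by rewrite sqrtr_gt0.
have SE0 : S ^+ 2 = E0 by rewrite sqr_sqrtr// ltW.
have u_le : enorm u <= 3 / 2 * S.
  apply: le_of_sqr; first by rewrite mulr_ge0// ltW.
  by rewrite uE exprMn SE0; lra.
have : ((qform (d3mul (energy2d f) y w) w / enorm w ^+ 3)%:E <= D0 f)%E.
  by apply: ereal_sup_ubound; exists y, w.
case: (D0 f) init => [D| |//] init.
- rewrite lee_fin ler_pdivrMr ?exprn_gt0// => qle.
  have [D0|Dpos] := leP D 0.
    by rewrite (le_trans qle)// (le_trans _ K0)// mulr_le0_ge0// exprn_ge0// ltW.
  have den0 : 0 < tau * D * s ^+ 3 by rewrite !mulr_gt0.
  move: init; rewrite -!EFinM inver gt_eqF// lee_fin ler_pdivlMr// => init.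
  apply: (le_trans qle); apply: (@le_trans _ _ (D * (tau * (s * enorm u)) ^+ 3)).
    by rewrite ler_pM2l//; apply: lerXn2r; rewrite ?nnegrE ?mulr_ge0 ?enorm_ge0// ltW.
  have -> : D * (tau * (s * enorm u)) ^+ 3
      = tau ^+ 2 * (tau * D * s ^+ 3) * enorm u ^+ 2 * enorm u by ring.
  rewrite uE.
  apply: (@le_trans _ _ (tau ^+ 2 * (tau * D * s ^+ 3) * (2 * E) * (3 / 2 * S))).
    by rewrite ler_wpM2l// !mulr_ge0// ?sqr_ge0// ltW.
  have -> : tau ^+ 2 * (tau * D * s ^+ 3) * (2 * E) * (3 / 2 * S)
    = 3 * tau ^+ 2 * E * (S * (tau * D * s ^+ 3)) by field.
  by rewrite /K [leRHS]mulrAC ler_wpM2l// !mulr_ge0// ltW.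
- move: init; rewrite gt0_muley ?lte_fin// gt0_mulye ?lte_fin// invey mule0.
  by rewrite lee_fin leNgt S0.
Qed.

(** The eigenvalues of [2 / (mu + L) *: M - 1%:M] lie between -1 and 1, so its
bilinear form at [(g, p)] is at least [- (|g|^2 + |p|^2) / 2]. This is obtained
by polarisation, from [M <= L] at [g - p] and [mu <= M] at [g + p]; and
[mu <= M] at [g] bounds the diagonal term. *)
Lemma first_order_ge n (M : 'M[R]_n) (mu L : R) (g p : 'cV[R]_n) :
  0 < mu -> mu <= L -> loewner_le mu%:M M -> loewner_le M L%:M ->
  2^-1 * (dot g g + dot p p)
    <= dot (mu^-1 *: g + (2 / (mu + L)) *: p) (M *m g) + dot (p - g) p.
Proof.
move=> mu0 muL Mge Mle.
have L0 : 0 < mu + L by rewrite addr_gt0// (lt_le_trans mu0).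
have Ms := loewner_ge_scalar_sym Mge.
have Msym u v : dot u (M *m v) = dot v (M *m u) by rewrite dotC dot_mulmx Ms.
have := loewner_ge_scalar g Mge.
have := loewner_ge_scalar (g + p) Mge; have := loewner_le_scalar (g - p) Mle.
rewrite !qform_dot -scaleN1r -[- g]scaleN1r !mulmxDr -!scalemxAr.
rewrite !(dotDl, dotDr, dotZl, dotZr) (Msym g p) (dotC p g).
set G := dot g g; set P := dot p p; set X := dot g p.
set Qg := dot g _; set Qp := dot p (M *m p); set b := dot p (M *m g).
move=> Hm Hp Hg.
have PX : 0 <= dot (g + p) (g + p) by exact: dotvv_ge0.
have GP0 : 0 <= G + P by rewrite addr_ge0// dotvv_ge0.
have Hg' : G <= mu^-1 * Qg by rewrite ler_pdivlMl.
have Hb : X - (G + P) / 2 <= 2 / (mu + L) * b.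
  rewrite mulrAC ler_pdivlMr//.
  have : 0 <= (G + P) * mu by rewrite mulr_ge0// ltW.
  lra.
lra.
Qed.

(** The step has size [tau * a], and [a <= mu] compensates for the factors
[mu^-1] and [2 / (mu + L) <= mu^-1] in [q]: both [a ^+ 2 * |q|^2] and
[a ^+ 2 * |p - g|^2] are at most [4 * E]. *)
Lemma second_order_le n (M C : 'M[R]_n) (mu L L' a tau E : R) (g p q : 'cV[R]_n) :
  0 < mu -> mu <= 1 -> mu <= L -> 0 < a -> a <= mu -> 0 < L' ->
  loewner_le (C^T *m M *m C) L'%:M -> 2 * E = dot g g + dot p p ->
  q = mu^-1 *: g + (2 / (mu + L)) *: p ->
  qform M (- (tau * a) *: (C *m q)) + dot (- (tau * a) *: (p - g)) (- (tau * a) *: (p - g))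
    <= 8 * tau ^+ 2 * Num.max L' 1 * E.
Proof.
move=> mu0 mu1 muL a0 amu L'0 Mle EE qE.
have L0 : 0 < mu + L by rewrite addr_gt0// (lt_le_trans mu0).
have GP0 : 0 <= 2 * E by rewrite EE addr_ge0// dotvv_ge0.
have -> : qform M (- (tau * a) *: (C *m q)) = (tau * a) ^+ 2 * qform (C^T *m M *m C) q.
  rewrite !qform_dot -!scalemxAr dotZl dotZr mulrA mulrNN -expr2.
  by rewrite dot_mulmx -!mulmxA.
have q_le : a ^+ 2 * dot q q <= 4 * E.
  have -> : a ^+ 2 * dot q q = dot (a *: q) (a *: q) by rewrite dotZl dotZr; ring.
  have -> : a *: q = (a / mu) *: g + (a * (2 / (mu + L))) *: p by rewrite qE scalerDr !scalerA.
  set r := a / mu; set k := a * _.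
  have r01 : 0 <= r <= 1 by rewrite divr_ge0 ?ler_pdivrMr ?mul1r// ltW.
  have k01 : 0 <= k <= 1.
    apply/andP; split; first by rewrite /k mulr_ge0 ?divr_ge0// ltW.
    by rewrite /k mulrA ler_pdivrMr//; lra.
  have := dotvv_ge0 (r *: g - k *: p).
  rewrite -scaleN1r !(dotDl, dotDr, dotZl, dotZr) (dotC p g).
  have := dotvv_ge0 g; have := dotvv_ge0 p; move: EE.
  move: (dot g g) (dot p p) (dot g p) => G P X EE P0 G0 H.
  have rr : r * r * G <= G by rewrite ler_piMl//; nra.
  have kk : k * k * P <= P by rewrite ler_piMl//; nra.
  nra.
have pg_le : a ^+ 2 * dot (p - g) (p - g) <= 4 * E.
  have := dotvv_ge0 (p + g); have := dotvv_ge0 (p - g).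
  rewrite -scaleN1r !(dotDl, dotDr, dotZl, dotZr) (dotC p g).
  move: EE; move: (dot g g) (dot p p) (dot g p) => G P X EE H1 H2.
  have a1 : a ^+ 2 <= 1 by nra.
  apply: (@le_trans _ _ (P + -1 * X + (-1 * X + -1 * (-1 * G)))); last by lra.
  by rewrite ler_piMl//; lra.
rewrite dotZl dotZr.
have := loewner_le_scalar q Mle.
set Q := qform _ _; set Y := dot (p - g) _ in pg_le *; set Z := dot q q in q_le *.
move=> QZ; set m := Num.max L' 1.
have mL : L' <= m by rewrite le_max lexx.
have m1 : 1 <= m by rewrite le_max lexx orbT.
have h1 : a ^+ 2 * Q <= m * (4 * E).
  apply: (@le_trans _ _ (a ^+ 2 * (L' * Z))); first by rewrite ler_wpM2l ?sqr_ge0.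
  rewrite mulrCA; apply: (@le_trans _ _ (L' * (4 * E))); first by rewrite ler_pM2l.
  by rewrite ler_wpM2r//; lra.
have h2 : a ^+ 2 * Y <= m * (4 * E).
  apply: (le_trans pg_le); rewrite ler_peMl//; lra.
have -> : (tau * a) ^+ 2 * Q + - (tau * a) * (- (tau * a) * Y)
  = tau ^+ 2 * (a ^+ 2 * Q + a ^+ 2 * Y) by ring.
have -> : 8 * tau ^+ 2 * m * E = tau ^+ 2 * (m * (4 * E) + m * (4 * E)) by ring.
by rewrite ler_wpM2l ?sqr_ge0// lerD.
Qed.

End Step.

(** * One step of the algorithm *)

Section Main.
Context {R : realType}.

(** The parameters make all the coefficients of the scheme multiples of a single
[a], whose inverse is [2 / (mu + L) + mu^-1]: indeed [tau + gamma = mu^-1] and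
[1 - gamma * A = A * (2 / (mu + L))]. The bounds on [a] follow from
[0 <= 2 / (mu + L) <= mu^-1]. *)
Lemma step_scalars (mu L tau gamma A : R) :
  0 < mu -> mu <= L -> 0 < tau -> 0 < gamma -> gamma = (1 - tau * mu) / mu ->
  A = (mu + L) / (2 + (mu + L) * gamma) ->
  let a := A / (1 + tau * A) in
  [/\ 0 < a, mu / 2 <= a, a <= mu & [/\ 1 / (1 + tau * A) = 1 - tau * a,
    (1 - gamma * A) / (1 + tau * A) = a * (2 / (mu + L)) &
    (tau * A + gamma * A) / (1 + tau * A) = a * mu^-1]].
Proof.
move=> mu0 muL tau0 gamma0 gammaE AE a.
have L0 : 0 < mu + L by rewrite addr_gt0// (lt_le_trans mu0).
have D0 : 0 < 2 + (mu + L) * gamma by rewrite addr_gt0// mulr_gt0.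
have A0 : 0 < A by rewrite AE divr_gt0.
have T0 : 0 < 1 + tau * A by rewrite addr_gt0// mulr_gt0.
have nL := lt0r_neq0 L0; have nD := lt0r_neq0 D0; have nT := lt0r_neq0 T0.
have nmu := lt0r_neq0 mu0.
have a0 : 0 < a by rewrite divr_gt0.
have tg : tau + gamma = mu^-1 by rewrite gammaE; field.
have A1 : 1 - gamma * A = A * (2 / (mu + L)).
  by rewrite AE; field; rewrite nL nD.
have E1 : (1 - gamma * A) / (1 + tau * A) = a * (2 / (mu + L)).
  by rewrite A1 /a mulrAC.
have E2 : (tau * A + gamma * A) / (1 + tau * A) = a * mu^-1.
  by rewrite -mulrDl tg /a; field; rewrite nmu nT.
have E3 : 1 / (1 + tau * A) = 1 - tau * a by rewrite /a; field.
have aE : a * (2 / (mu + L)) + a * mu^-1 = 1.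
  by rewrite -E1 -E2; field.
have k1 : a * (2 / (mu + L)) <= a * mu^-1.
  by rewrite ler_pM2l// ler_pdivrMr// mulrC ler_pdivlMr//; lra.
have k0 : 0 <= a * (2 / (mu + L)) by rewrite mulr_ge0 ?divr_ge0// ltW.
split=> //.
- have : 2^-1 <= a * mu^-1 by lra.
  by rewrite ler_pdivlMr//; lra.
- have : a * mu^-1 <= 1 by lra.
  by rewrite ler_pdivrMr//; lra.
Qed.

Lemma energy2d_col d (f : 'cV[R]_d -> R) (x p : 'cV[R]_d) :
  energy2d f (col_mx x p) = energy f x p.
Proof. by rewrite /energy2d col_mxKu col_mxKd. Qed.

Lemma energy_double d (f : 'cV[R]_d -> R) (x p : 'cV[R]_d) :
  2 * energy f x p = dot (grad f x) (grad f x) + dot p p.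
Proof. by rewrite /energy !enorm_sqr; field. Qed.

Lemma energy_ge0 d (f : 'cV[R]_d -> R) (x p : 'cV[R]_d) : 0 <= energy f x p.
Proof. by rewrite /energy addr_ge0// mulr_ge0// sqr_ge0. Qed.

(** The scheme enters only through the form that [step_scalars] gives to its
step. Transposing [B *m H] turns the gradient term into one of [H *m B *m H],
where [first_order_ge] applies. *)
Lemma energy_step d (f : 'cV[R]_d -> R) (B : 'M[R]_d) (x p q : 'cV[R]_d)
    (mu L L' a tau K : R) :
  Ck 4 f -> B^T = B -> 0 < mu -> mu <= L -> mu <= 1 -> 0 < L' ->
  0 < tau -> 0 < a -> a <= mu ->
  loewner_le mu%:M (hess f x *m B *m hess f x) ->
  loewner_le (hess f x *m B *m hess f x) L%:M ->
  loewner_le ((B *m hess f x)^T *m (d3mul f x (grad f x) + hess f x *m hess f x)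
     *m (B *m hess f x)) L'%:M ->
  q = mu^-1 *: grad f x + (2 / (mu + L)) *: p ->
  let w := col_mx (- (tau * a) *: (B *m hess f x *m q))
                  (- (tau * a) *: (p - grad f x)) in
  (forall y, qform (d3mul (energy2d f) y w) w <= K) ->
  energy2d f (col_mx x p + w) <= energy f x p - tau * a * energy f x p
    + 4 * tau ^+ 2 * Num.max L' 1 * energy f x p + K / 6.
Proof.
move=> Cf Bs mu0 muL mu1 L'0 tau0 a0 amu C0ge C0le Mle qE w leK.
apply: (le_trans (taylor3_line (col_mx x p) (Ck_energy2d Cf) leK)).
rewrite derive_energy2d_grad// derive2_energy2d_hess// energy2d_col.
rewrite !col_mxKu !col_mxKd.
have := second_order_le tau mu0 mu1 muL a0 amu L'0 Mle (energy_double f x p) qE.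
have := first_order_ge (grad f x) p mu0 muL C0ge C0le; rewrite -qE -energy_double.
have Hs : (hess f x)^T = hess f x by apply/hess_sym/CkS/CkS.
have -> : dot (- (tau * a) *: (B *m hess f x *m q)) (hess f x *m grad f x)
    = - (tau * a) * dot q (hess f x *m B *m hess f x *m grad f x).
  by rewrite dotZl dot_mulmx trmx_mul Hs Bs !mulmxA.
rewrite [dot (_ *: _) p]dotZl; set E := energy f x p; set T1 := dot q _; set T2 := dot (p - _) p.
set S := qform _ _ + _; move=> F1 F2.
have ta0 : 0 < tau * a by rewrite mulr_gt0.
have : tau * a * E <= tau * a * (T1 + T2) by rewrite ler_pM2l//; lra.
lra.
Qed.

End Main.

Theorem theorem3p10 (R : realType) (d : nat)
  (f : 'cV[R]_d -> R) (B : 'cV[R]_d -> 'M[R]_d)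
  (L mu L' tau sigma A eps omega gamma delta : R)
  (x p : nat -> 'cV[R]_d)
  (f_C4 : Ck 4 f) (f_sc : strongly_convex f)
  (B_pd : forall y, pdmx (B y))
  (mu_gt0 : 0 < mu) (mu_le_L : mu <= L) (mu_le1 : mu <= 1)
  (C0_ge : forall y, loewner_le (mu%:M) (C0mx f B y))
  (C0_le : forall y, loewner_le (C0mx f B y) (L%:M))
  (L'_gt0 : 0 < L')
  (third_le : forall y,
     loewner_le ((Cmx f B y)^T
                 *m (d3mul f y (grad f y) + hess f y *m hess f y)
                 *m Cmx f B y)
                (L'%:M))
  (tau_gt0 : 0 < tau) (sigma_gt0 : 0 < sigma) (A_gt0 : 0 < A)
  (eps_gt0 : 0 < eps) (omega_gt0 : 0 < omega)
  (gamma_omega : gamma = sigma * omega)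
  (iterates : lpdd_iterates f B tau sigma A eps gamma x p)
  (sigma_eq : sigma = tau)
  (gamma_eq : gamma = (1 - sigma * mu) / mu)
  (eps_eq : eps = 1)
  (A_eq : A = (mu + L) / (2 + (mu + L) * eps * gamma))
  (delta_gt0 : 0 < delta)
  (init_le : forall y,
     ((Num.sqrt (energy f (x 0%N) (p 0%N)))%:E
      <= delta%:E / (tau%:E * D0 f *
           (spectral_norm (Nmx f B tau sigma A eps gamma y) ^+ 3)%:E))%E)
  (tau_eq : tau = 1 / 4 * (mu / (delta + 36 * Num.max L' 1))) :
  forall n : nat,
    energy f (x n) (p n) <=
      energy f (x 0%N) (p 0%N)
      * (1 - (mu ^+ 2 / 32) / (delta + 36 * Num.max L' 1)) ^+ n.
Proof.
subst sigma eps.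
have gamma0 : 0 < gamma by rewrite gamma_omega mulr_gt0.
rewrite mulr1 in A_eq.
have [a0 amu2 amu [c3 c1 c2]] := step_scalars mu_gt0 mu_le_L tau_gt0 gamma0 gamma_eq A_eq.
set a := A / (1 + tau * A) in a0 amu2 amu c3 c1 c2.
set m := Num.max L' 1 in tau_eq *; set Dn := delta + 36 * m in tau_eq *.
have m1 : 1 <= m by rewrite le_max lexx orbT.
have Dn0 : 0 < Dn by rewrite /Dn; lra.
set r := mu ^+ 2 / 32 / Dn.
have r0 : 0 <= r by rewrite !divr_ge0// ?sqr_ge0// ltW.
have r1 : r <= 1.
  rewrite ler_pdivrMr// mul1r (@le_trans _ _ 1)//; last by rewrite /Dn; lra.
  by nra.
have step n : energy f (x n) (p n) <= energy f (x 0%N) (p 0%N) ->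
    energy f (x n.+1) (p n.+1) <= energy f (x n) (p n) * (1 - r).
  move=> En0; set E := energy f (x n) (p n) in En0 *.
  pose g := grad f (x n); pose C := B (x n) *m hess f (x n).
  pose q := mu^-1 *: g + (2 / (mu + L)) *: p n.
  pose w := col_mx (- (tau * a) *: (C *m q)) (- (tau * a) *: (p n - g)).
  have E0 : 0 <= E := energy_ge0 f _ _.
  (* Block rows: x-part by c1 and c2, p-part by the choice sigma = tau. *)
  have wN : w = - tau *: (Nmx f B tau tau A 1 gamma (x n) *m col_mx g (p n)).
    rewrite /Nmx -scalemxAl mul_block_col divff ?lt0r_neq0// mulr1 !mul1r.
    rewrite -!scalemxAl !mul_scalar_mx scalerA scale_col_mx -/C; congr col_mx.
      rewrite /q mulmxDr -!scalemxAr !scalerDr !scalerA.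
      by congr (_ *: _ + _ *: _); rewrite mulNr -[tau * a * _]mulrA -?c1 -?c2; ring.
    rewrite !scalerDr !scalerA addrC scalerN -scaleNr.
    by congr (_ *: _ + _ *: _); rewrite /a; ring.
  have zS : col_mx (x n.+1) (p n.+1) = col_mx (x n) (p n) + w.
    have [pE xE] := iterates n; rewrite pE xE add_col_mx mulr1 mul1r.
    congr col_mx.
      have aq : ((1 - gamma * A) / (1 + tau * A)) *: p n
          + ((tau * A + gamma * A) / (1 + tau * A)) *: g = a *: q.
        by rewrite c1 c2 /q scalerDr !scalerA addrC.
      by rewrite aq -/C -scalemxAr scalerA scaleNr.
    rewrite -/g c3 -[tau * A / _]mulrA -/a scalerBl scale1r.
    by rewrite scaleNr scalerBr opprB addrCA addrC.
  have uE : enorm (col_mx g (p n)) ^+ 2 = 2 * E.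
    by rewrite enorm_col_mx !enorm_sqr energy_double.
  (* This is where the energy at step n must not exceed the initial one. *)
  have leK := third_order_le tau_gt0 delta_gt0 E0 En0 uE (init_le (x n)).
  rewrite -wN in leK.
  have := energy_step f_C4 (B_pd (x n)).1 mu_gt0 mu_le_L mu_le1 L'_gt0 tau_gt0
    a0 amu (C0_ge (x n)) (C0_le (x n)) (third_le (x n)) erefl leK.
  rewrite -zS energy2d_col -/E -/m => H; apply: (le_trans H).
  have tD : tau * Dn = mu / 4 by rewrite tau_eq; field; exact: lt0r_neq0.
  (* The rate r is half of the decrease tau * mu / 4 that is available. *)
  have rE : r = tau * mu / 8 by rewrite /r tau_eq; field; exact: lt0r_neq0.
  have -> : E - tau * a * E + 4 * tau ^+ 2 * m * E + 3 * tau ^+ 2 * delta * E / 6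
    = E * (1 - tau * (a - tau * (4 * m + delta / 2))) by field.
  apply: ler_wpM2l => //; rewrite lerD2l lerN2 rE -mulrA ler_pM2l//.
  have : tau * (4 * m + delta / 2) <= tau * Dn.
    by rewrite ler_pM2l// /Dn; lra.
  rewrite tD; lra.
have bound n : energy f (x n) (p n) <= energy f (x 0%N) (p 0%N) * (1 - r) ^+ n.
  elim: n => [|n IH]; first by rewrite expr0 mulr1.
  have r10 : 0 <= 1 - r by lra.
  rewrite exprSr mulrA; apply: le_trans (step n _) _; last first.
    by rewrite ler_wpM2r.
  apply: (le_trans IH); rewrite ler_piMr ?energy_ge0// exprn_ile1//; lra.
exact: bound.
Qed.
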